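(* Suppose that $m=m(n)$ and $s=s(n)$ are positive parameters. Let $\mathcal{C}=\mathcal{C}(n)$ and $\mathcal{V}=\mathcal{V}(n)$ be sets. For every $0\le i\le m$ set $t=t(i):=i/s$. Suppose we have a filtration $\mathcal{F}_0\subseteq\mathcal{F}_1\subseteq\cdots$ and random variables $X_\sigma(i)$ and $Y^{\pm}_\sigma(i)$ which satisfy the following. For all $\sigma\in\mathcal{C}\times\mathcal{V}$ the random variables $X_\sigma(i)$ are non-negative and $\mathcal{F}_i$-measurable for all $0\le i\le m$, and for all $0\le i<m$ the random variables $Y^+_\sigma(i)$ and $Y^-_\sigma(i)$ are non-negative, $\mathcal{F}_{i+1}$-measurable and satisfy $$X_\sigma(i+1)-X_\sigma(i)=Y^+_\sigma(i)-Y^-_\sigma(i).$$ Suppose that for all $0\le i\le m$ and $\Sigma\in\mathcal{C}$ we have an event $\mathcal{B}_i(\Sigma)\in\mathcal{F}_i$, and define $\mathcal{B}_{\le i}(\Sigma):=\bigcup_{0\le j\le i}\mathcal{B}_j(\Sigma)$. Suppose that for each $\sigma\in\mathcal{C}\times\mathcal{V}$ we have positive parameters $u_\sigma=u_\sigma(n)$, $\lambda_\sigma=\lambda_\sigma(n)$, $\beta_\sigma=\beta_\sigma(n)$, $\tau_\sigma=\tau_\sigma(n)$, $s_\sigma=s_\sigma(n)$ and $S_\sigma=S_\sigma(n)$, as well as functions $x_\sigma(t)$ and $f_\sigma(t)$ that are smooth and non-negative for $t\ge0$. For all $0\le i^*\le m$ and $\Sigma\in\mathcal{C}$, let $\mathcal{G}_{i^*}(\Sigma)$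 denote the event that for every $0\le i\le i^*$ and $\sigma=(\Sigma,j)$ with $j\in\mathcal{V}$ we have $$X_\sigma(i)=\left(x_\sigma(t)\pm\frac{f_\sigma(t)}{s_\sigma}\right)S_\sigma .$$ For all $0\le i^*\le m$ let $\mathcal{E}_{i^*}$ denote the event that for every $0\le i\le i^*$ and $\Sigma\in\mathcal{C}$ the event $\mathcal{B}_{\le i-1}(\Sigma)\cup\mathcal{G}_i(\Sigma)$ holds. Moreover, assume that we have an event $\mathcal{H}_i\in\mathcal{F}_i$ for all $0\le i\le m$ with $\mathcal{H}_{i+1}\subseteq\mathcal{H}_i$ for all $0\le i<m$. Finally, suppose that the following conditions hold. 1. (Trend hypothesis) For all $0\le i<m$ and $\sigma=(\Sigma,j)\in\mathcal{C}\times\mathcal{V}$, whenever $\mathcal{E}_i\cap\neg\mathcal{B}_{\le i}(\Sigma)\cap\mathcal{H}_i$ holds we have, both for the sign $+$ and for the sign $-$ in place of $\pm_1$, $$\mathbb{E}\big[Y^{\pm_1}_\sigma(i)\mid\mathcal{F}_i\big]=\left(y^{\pm_1}_\sigma(t)\pm\frac{h_\sigma(t)}{s_\sigma}\right)\frac{S_\sigma}{s},$$ where $y^{+}_\sigma(t)$, $y^-_\sigma(t)$ and $h_\sigma(t)$ are smooth non-negative functions such that $$x'_\sigma(t)=y^+_\sigma(t)-y^-_\sigma(t)\qquad\text{and}\qquad f_\sigma(t)\ge2\int_0^t h_\sigma(\tau)\,d\tau+\beta_\sigma .$$ 2. (Boundedness hypothesis) For all $0\le i<m$ and $\sigma=(\Sigma,j)\in\mathcal{C}\times\mathcal{V}$,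 whenever $\mathcal{E}_i\cap\neg\mathcal{B}_{\le i}(\Sigma)\cap\mathcal{H}_i$ holds we have (for both signs) $$Y^{\pm}_\sigma(i)\le\frac{\beta_\sigma^2}{s_\sigma^2\lambda_\sigma\tau_\sigma}\cdot\frac{S_\sigma}{u_\sigma}.$$ 3. (Initial conditions) For all $\sigma\in\mathcal{C}\times\mathcal{V}$ we have $$X_\sigma(0)=\left(x_\sigma(0)\pm\frac{\beta_\sigma}{3s_\sigma}\right)S_\sigma .$$ 4. (Bounded number of configurations and variables) We have $$\max\{|\mathcal{C}|,|\mathcal{V}|\}\le\min_{\sigma\in\mathcal{C}\times\mathcal{V}}e^{u_\sigma}.$$ 5. (Additional technical assumptions) For all $\sigma\in\mathcal{C}\times\mathcal{V}$ we have $$s\ge\max\{15u_\sigma\tau_\sigma(s_\sigma\lambda_\sigma/\beta_\sigma)^2,\;9s_\sigma\lambda_\sigma/\beta_\sigma\},\qquad s/(18s_\sigma\lambda_\sigma/\beta_\sigma)<m\le s\cdot\tau_\sigma/1944,$$ $$\sup_{0\le t\le m/s}y^{\pm}_\sigma(t)\le\lambda_\sigma,\qquad\int_0^{m/s}|x''_\sigma(t)|\,dt\le\lambda_\sigma,$$ $$h_\sigma(0)\le s_\sigma\lambda_\sigma\qquad\text{and}\qquad\int_0^{m/s}|h'_\sigma(t)|\,dt\le s_\sigma\lambda_\sigma .$$ Then we have $$\mathbb{P}[\neg\mathcal{E}_m\cap\mathcal{H}_m]\le4\max_{\sigma\in\mathcal{C}\times\mathcal{V}}e^{-u_\sigma}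.$$
   Context: The notation $a\pm b$ denotes the interval $\{a+xb:-1\le x\le1\}$, where multiple (unlabelled) occurrences of $\pm$ are treated independently, and $x=a\pm b$ means $x\in a\pm b$; e.g. $X=(x\pm y)S$ means $X=(x+\theta y)S$ for some $\theta\in[-1,1]$. A labelled sign $\pm_1$ means that two statements are made, one with every $\pm_1$ replaced by $+$ and one with every $\pm_1$ replaced by $-$. The superscript in $Y^\pm_\sigma$, $y^\pm_\sigma$ indicates the two objects $Y^+_\sigma,Y^-_\sigma$ (resp. $y^+_\sigma,y^-_\sigma$). The index $i$ ranges over integers, $m$ is an integer (rounding is suppressed), and $\mathcal{B}_{\le-1}(\Sigma)$ is the empty union, i.e. the empty event. $\neg\mathcal{A}$ is the complement of the event $\mathcal{A}$. *)

(* Defs.v *)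
From HB Require Import structures.
From mathcomp Require Export all_boot all_order all_algebra.
From mathcomp Require Export all_classical all_reals all_analysis.
From mathcomp Require Export measurable_realfun.
Export Order.TTheory GRing.Theory Num.Theory.
Export numFieldNormedType.Exports.

Set Implicit Arguments.
Unset Strict Implicit.
Unset Printing Implicit Defensive.

Local Open Scope classical_set_scope.
Local Open Scope ring_scope.

Variant sign := Plus | Minus.

(* The interval a ± b = {a + θ b : -1 <= θ <= 1}. *)
Definition pm {R : realType} (a b : R) : set R :=
  [set a + theta * b | theta in `[-1, 1]].

(* v = (a ± b) S *)
Definition is_pm {R : realType} (v a b S : R) : Prop :=
  exists2 z, pm a b z & v = z * S.

(* Derivative of a function on [0, +oo[: two-sided at t > 0, one-sided at 0.
   The values of f on the negative half-line play no role. *)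
Definition quotient_filter {R : realType} (t : R) : set_system R :=
  within [set h | 0 <= t + h] 0^'.

Definition diff_quotient {R : realType} (f : R -> R) (t h : R) : R :=
  h^-1 * (f (t + h) - f t).

Definition hl_deriv {R : realType} (f : R -> R) (t : R) : R :=
  lim (diff_quotient f t h @[h --> quotient_filter t]).

(* f is infinitely differentiable on [0, +oo[ *)
Definition smooth {R : realType} (f : R -> R) : Prop :=
  forall (k : nat) (t : R), 0 <= t ->
    cvg (diff_quotient (iter k hl_deriv f) t h @[h --> quotient_filter t]).

Definition smooth_nonneg {R : realType} (f : R -> R) : Prop :=
  smooth f /\ forall t, 0 <= t -> 0 <= f t.

Definition filtration {d : measure_display} {T : measurableType d}
    (F : nat -> set_system T) : Prop :=
  [/\ forall i, sigma_algebra setT (F i),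
      forall i, F i `<=` measurable
    & forall i j, (i <= j)%N -> F i `<=` F j].

(* f is measurable with respect to the sigma-algebra G *)
Definition measurable_wrt {T : Type} {d' : measure_display}
    {U : measurableType d'} (G : set_system T) (f : T -> U) : Prop :=
  preimage_set_system setT f measurable `<=` G.

(* Z is a version of E[Y | G] for a non-negative random variable Y.  As for
   any non-negative Y, no integrability is needed, at the cost of letting Z
   take the value +oo; versions exist and are almost surely unique. *)
Definition is_condexp {d : measure_display} {T : measurableType d}
    {R : realType} (P : probability T R) (G : set_system T)
    (Y : T -> R) (Z : T -> \bar R) : Prop :=
  [/\ measurable_wrt G Z,
      forall w, (0 <= Z w)%E
    & forall A, G A ->
        (\int[P]_(w in A) Z w = \int[P]_(w in A) (Y w)%:E)%E].

(* upto B k Sg is the event B_{<= k-1}(Sg); thus B_{<= i}(Sg) is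
   upto B i.+1 Sg, and upto B 0 Sg is empty. *)
Definition upto {T C : Type} (B : nat -> C -> set T) (k : nat) (Sg : C) :
    set T :=
  \bigcup_(j in [set j | (j < k)%N]) B j Sg.

Definition event_G {T : Type} {R : realType} {C V : Type} (s : R)
    (X : C * V -> nat -> T -> R) (x f : C * V -> R -> R)
    (ssg Ssg : C * V -> R) (istar : nat) (Sg : C) : set T :=
  [set w | forall (i : nat) (j : V), (i <= istar)%N ->
    let sg := (Sg, j) in let t := i%:R / s in
    is_pm (X sg i w) (x sg t) (f sg t / ssg sg) (Ssg sg)].

Definition event_E {T : Type} {R : realType} {C V : Type} (s : R)
    (X : C * V -> nat -> T -> R) (B : nat -> C -> set T)
    (x f : C * V -> R -> R) (ssg Ssg : C * V -> R) (istar : nat) : set T :=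
  [set w | forall (i : nat) (Sg : C), (i <= istar)%N ->
    (upto B i Sg `|` event_G s X x f ssg Ssg i Sg) w].

(* Main.v *)
Require Import Defs.
From mathcomp Require Import ring lra.

Local Open Scope classical_set_scope.
Local Open Scope ring_scope.

(** Suppose [E m] fails on [H m] and let [i] be the first time at which [E]
    fails, with witness [sg = (Sg, j)].  Before time [i] the trend and
    boundedness hypotheses for [sg] are in force.  Replacing the sums of
    [x'] and [h] over the grid [k / s] by integrals costs at most
    [3 lambda S / s <= beta S / (3 ssg)], and the initial error costs as much,
    so for one of the signs the sum of the [Y k], compared with the sum of the
    upper or lower bounds [c k] on its conditional means, is off in the wrong
    direction by at least [a = beta S / (6 ssg)].

    For a random variable [0 <= Y <= N] with conditional mean at most [M], and
    [theta N <= 1 / 3], the inequality [exp z <= 1 + z + z ^ 2] gives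
    [E exp (theta Y) <= exp (theta c + theta ^ 2 N M)], where [c] bounds the
    mean from above or below according to the sign of [theta].  Hence the
    exponential of [theta] times the centred sum, stopped at the failure
    time, has mean at most [exp (m theta ^ 2 N M)].  For
    [theta = 36 ssg u / (beta S)] one has [theta a = 6 u] and
    [m theta ^ 2 N M <= 2 u], so each deviation has probability at most
    [exp (- 3 u)]; there are [4 |C| |V|] of them and [|C| |V| <= exp (2 u)]. *)

(** * Conditional exponential moments *)

Lemma sigma_algebra_measurableW {T : pointedType} (G : set_system T) (A : set T) :
  sigma_algebra setT G -> measurable (A : set (g_sigma_algebraType G)) -> G A.
Proof. by move=> sG; rewrite measurable_g_measurableTypeE. Qed.

Lemma measurable_wrtE {T : pointedType} {d' : measure_display}
    {U : measurableType d'} (G : set_system T) (f : T -> U) :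
  sigma_algebra setT G ->
  measurable_wrt G f <-> measurable_fun setT (f : g_sigma_algebraType G -> U).
Proof.
move=> sG; split=> [fG _ A mA|mf _ [A mA <-]].
  by rewrite measurable_g_measurableTypeE//; apply: fG; exists A.
by rewrite -(measurable_g_measurableTypeE sG); exact: mf.
Qed.

Lemma measurable_wrt_measurable {d : measure_display} {T : measurableType d}
    {d' : measure_display} {U : measurableType d'} (G : set_system T) (f : T -> U) :
  G `<=` measurable -> measurable_wrt G f -> measurable_fun setT f.
Proof. by move=> Gm fG _ A mA; apply/Gm/fG; exists A. Qed.

Lemma measurable_wrtS {T : Type} {d' : measure_display}
    {U : measurableType d'} (G G' : set_system T) (f : T -> U) :
  G `<=` G' -> measurable_wrt G f -> measurable_wrt G' f.
Proof. by move=> GG' fG; exact: subset_trans GG'. Qed.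

Import HBNNSimple.

(** Both sides are linear in [W], so the inequality passes from indicators of sets of [G] to simple
    functions and, by monotone convergence, to [W]. This does the work of taking a known factor out
    of a conditional expectation. *)
Lemma le_integral_weight {d : measure_display} {T : measurableType d}
    {R : realType} (mu : {measure set T -> \bar R}) (G : set_system T)
    (f g W : T -> R) :
  sigma_algebra setT G -> G `<=` measurable ->
  (forall w, 0 <= f w) -> (forall w, 0 <= g w) -> (forall w, 0 <= W w) ->
  measurable_fun setT f -> measurable_fun setT g -> measurable_wrt G W ->
  (forall A, G A ->
    (\int[mu]_(w in A) (f w)%:E <= \int[mu]_(w in A) (g w)%:E)%E) ->
  (\int[mu]_w (W w * f w)%:E <= \int[mu]_w (W w * g w)%:E)%E.
Proof.
move=> sG Gm f0 g0 W0 mf mg /(measurable_wrtE _ _ sG) mW fg.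
have mW' : measurable_fun [set: g_sigma_algebraType G] (EFin \o W).
  exact/measurable_EFinP.
(* The approximation is made on the space carrying only [G], so that the level sets of [h n] lie in
   [G]. *)
pose h := nnsfun_approx measurableT mW'.
have mh n : measurable_fun [set: T] (h n : T -> R).
  apply: (@measurable_wrt_measurable _ _ _ _ G) => //.
  by apply/measurable_wrtE => //; exact: measurable_funP.
have mhi n r : G (h n @^-1` [set r]).
  exact: sigma_algebra_measurableW.
have h0 n (w : T) : (0 <= h n w)%R by [].
have lim_int (k : T -> R) : (forall w, 0 <= k w)%R -> measurable_fun [set: T] k ->
    (\int[mu]_w (h n w * k w)%:E @[n --> \oo] --> \int[mu]_w (W w * k w)%:E)%E.
  move=> k0 mk; pose g' n w := (h n w * k w)%:E.
  have lm w : ((W w * k w)%:E = limn (g' ^~ w))%E.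
    apply/esym/cvg_lim => //; rewrite /g'.
    apply: cvg_EFin; first by apply: nearW.
    have -> : fine \o (fun n => (h n w * k w)%:E) = (fun n => h n w * k w) by [].
    apply: cvgMr_tmp.
    have hw : EFin \o h ^~ w @ \oo --> (EFin \o W) w.
      by apply: cvg_nnsfun_approx => // v _; rewrite lee_fin.
    by have /fine_cvgP[_] := hw.
  under eq_integral => w _ do rewrite lm.
  apply: (@cvg_monotone_convergence _ _ _ mu _ measurableT g').
  - by move=> n; apply/measurable_EFinP; exact: measurable_funM.
  - by move=> n w _; rewrite lee_fin mulr_ge0.
  - move=> w _ a b ab; rewrite lee_fin ler_wpM2r//.
    by have /lefP := nd_nnsfun_approx measurableT mW' ab; apply.
have int_h (k : T -> R) n : (forall w, 0 <= k w)%R -> measurable_fun [set: T] k ->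
    (\int[mu]_w (h n w * k w)%:E = \sum_(y \in range (h n))
       y%:E * \int[mu]_(w in h n @^-1` [set y]) (k w)%:E)%E.
  move=> k0 mk.
  transitivity (\int[mu]_w (\sum_(y \in range (h n))
      (y * \1_(h n @^-1` [set y]) w * k w)%:E))%E.
    apply: eq_integral => w _; rewrite fimfunE EFinM -fsumEFin//.
    rewrite ge0_mule_fsuml => [|y]; last exact: nnfun_muleindic_ge0.
    by apply: eq_fsbigr => y _; rewrite EFinM.
  rewrite ge0_integral_fsum//; last 2 first.
    - move=> y; apply/measurable_EFinP; apply: measurable_funM => //.
      apply: measurable_funM => //.
      by apply: measurable_indic; apply: Gm.
    - move=> y w _; have := nnfun_muleindic_ge0 (h n) y w.
      by rewrite !lee_fin => ?; rewrite mulr_ge0.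
  apply: eq_fsbigr => y /[!inE] -[w _ <-].
  under eq_integral do rewrite -mulrA EFinM.
  rewrite ge0_integralZl//.
  - congr (_ * _)%E; rewrite [RHS]integral_mkcond.
    apply: eq_integral => v _; rewrite epatch_indic -EFinM mulrC//.
  - apply/measurable_EFinP; apply: measurable_funM => //.
    by apply: measurable_indic; apply: Gm.
  - by move=> v _; rewrite lee_fin mulr_ge0.
  - by rewrite lee_fin.
apply: (lee_cvg_to (lim_int f f0 mf) (lim_int g g0 mg)).
apply: nearW => n; rewrite !int_h//; apply: lee_fsum => [|y [w _ <-]].
  exact: fimfunP.
by apply: lee_wpmul2l; [rewrite lee_fin|exact: fg].
Qed.

(** Squaring and inverting [1 - z / 2 <= expR (- (z / 2))] reduces the claim to
    [1 <= (1 - z / 2) ^ 2 * (1 + z + z ^ 2)], where the two sides differ by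
    [z ^ 2 * (1 - 3 * z + z ^ 2) / 4]. *)
Lemma expR_le_quadratic {R : realType} (z : R) :
  z <= 1 / 3 -> expR z <= 1 + z + z ^+ 2.
Proof.
move=> z3; have e0 : 1 - z / 2 <= expR (- (z / 2)) by exact: expR_ge1Dx.
have p0 : 0 < 1 - z / 2 by lra.
have -> : expR z = (expR (- (z / 2)) ^+ 2)^-1.
  by rewrite -expRM_natl -expRN; congr (expR _); lra.
apply: (@le_trans _ _ ((1 - z / 2) ^+ 2)^-1).
  rewrite lef_pV2 ?posrE ?exprn_gt0 ?expR_gt0//. rewrite ler_pXn2r ?nnegrE ?expR_ge0 ?(ltW p0)//.
rewrite -div1r ler_pdivrMr ?exprn_gt0//.
have : 0 <= z ^+ 2 * (1 - 3 * z + z ^+ 2) by apply: mulr_ge0; nra.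
lra.
Qed.

(** On [A] one has [Y ^ 2 <= N * Y], so the quadratic bound on the exponential becomes affine in [Y]
    and only the conditional mean matters. The form [theta * z <= theta * c] serves both signs of
    [theta]. *)
Lemma condexp_expR_le {d : measure_display} {T : measurableType d}
    {R : realType} (P : probability T R) (G : set_system T) (A : set T)
    (Y : T -> R) (Z : T -> \bar R) (theta c N M : R) :
  G `<=` measurable -> G A ->
  measurable_fun setT Y -> (forall w, 0 <= Y w) ->
  (forall w, A w -> Y w <= N) -> 0 <= N -> 0 <= M -> theta * N <= 1 / 3 ->
  is_condexp P G Y Z ->
  {ae P, forall w, A w -> exists2 z, Z w = z%:E & theta * z <= theta * c /\ z <= M} ->
  (\int[P]_(w in A) (expR (theta * Y w))%:E
    <= (expR (theta * c + theta ^+ 2 * N * M))%:E * P A)%E.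
Proof.
move=> Gm GA mY Y0 YN N0 M0 thN [mZ Z0 ZE] aeZ.
have mA : measurable A by exact: Gm.
have {}mZ : measurable_fun [set: T] Z := measurable_wrt_measurable _ _ Gm mZ.
set K := expR _.
(* [expR (theta * Y) <= 1 + g * Y] is kept in the form
   [expR (theta * Y) + gn * Y <= 1 + gp * Y], where all terms are nonnegative,
   so that extended-real integrals can be added freely. *)
pose g := theta + theta ^+ 2 * N.
pose gp := Num.max g 0; pose gn := Num.max (- g) 0.
have gp0 : 0 <= gp by rewrite le_max lexx orbT.
have gn0 : 0 <= gn by rewrite le_max lexx orbT.
have gE : gp = gn + g.
  by rewrite /gp /gn !maxEle; case: (leP g 0) => ?; case: (leP (- g) 0) => ?; lra.
have mYA : measurable_fun A (EFin \o Y).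
  by apply/measurable_EFinP; exact: measurable_funTS.
have mZA : measurable_fun A Z by exact: measurable_funTS.
pose I := (\int[P]_(w in A) (Y w)%:E)%E.
have I0 : (0 <= I)%E by apply: integral_ge0 => w _; rewrite lee_fin.
(* Finiteness is what allows [gn * I] to be cancelled at the end. *)
have Ifin : I \is a fin_num.
  rewrite ge0_fin_numE//.
  apply: (@le_lt_trans _ _ (\int[P]_(w in A) N%:E)%E).
    by apply: ge0_le_integral => //= w Aw; rewrite lee_fin//; exact: YN.
  rewrite integral_cst//= lte_mul_pinfty ?lee_fin//.
  by rewrite (le_lt_trans (probability_le1 _ mA)) ?ltry.
have mexp : measurable_fun A (fun w => (expR (theta * Y w))%:E).
  apply/measurable_EFinP; apply: measurableT_comp => //.
  by apply: measurable_funM => //; exact: measurable_funTS.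
have left : (\int[P]_(w in A) (expR (theta * Y w))%:E + gn%:E * I
    <= P A + gp%:E * I)%E.
  have -> : (P A = \int[P]_(w in A) 1%:E)%E by rewrite integral_cst// mul1e.
  rewrite /I -!ge0_integralZl//; try by move=> w _; rewrite lee_fin.
  rewrite -!ge0_integralD//=; try by move=> w _; rewrite lee_fin ?mulr_ge0 ?expR_ge0.
  - apply: ge0_le_integral => //=.
    + by move=> w _; rewrite lee_fin addr_ge0 ?mulr_ge0 ?expR_ge0.
    + by apply: emeasurable_funD => //; exact: measurable_funeM.
    + by apply: emeasurable_funD => //; exact: measurable_funeM.
    + move=> w Aw; rewrite lee_fin.
      have Yw0 := Y0 w; have YwN := YN w Aw.
      have /expR_le_quadratic h1 : theta * Y w <= 1 / 3.
        by have [t0|t0] := leP 0 theta; nra.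
      have h2 : 0 <= theta ^+ 2 * (Y w * (N - Y w)).
        by apply: mulr_ge0; [exact: sqr_ge0|apply: mulr_ge0 => //; lra].
      rewrite gE /g; lra.
  - exact: measurable_funeM.
  - exact: measurable_funeM.
have right : (P A + gp%:E * I <= K%:E * P A + gn%:E * I)%E.
  (* [Z] may replace [Y] under the integral because [A] lies in [G]. *)
  have -> : I = (\int[P]_(w in A) Z w)%E by rewrite ZE.
  have -> : (K%:E * P A = \int[P]_(w in A) K%:E)%E by rewrite integral_cst.
  have -> : (P A = \int[P]_(w in A) 1%:E)%E by rewrite integral_cst// mul1e.
  rewrite -!ge0_integralZl//.
  rewrite -!ge0_integralD//=; try by move=> w _; rewrite ?mule_ge0 ?lee_fin ?expR_ge0.
  - apply: ae_ge0_le_integral => //=.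
    + by move=> w _; rewrite adde_ge0 ?mule_ge0 ?lee_fin.
    + by apply: emeasurable_funD => //; exact: measurable_funeM.
    + by move=> w _; rewrite adde_ge0 ?mule_ge0 ?lee_fin ?expR_ge0.
    + by apply: emeasurable_funD => //; exact: measurable_funeM.
    + apply: filterS aeZ => w aeZ Aw; have [z zE [zc zM]] := aeZ Aw.
      rewrite zE -!EFinM -!EFinD lee_fin gE /g.
      have h1 : 1 + (theta * c + theta ^+ 2 * N * M) <= K by exact: expR_ge1Dx.
      have h2 : theta ^+ 2 * N * z <= theta ^+ 2 * N * M.
        by rewrite ler_wpM2l// mulr_ge0 ?sqr_ge0.
      lra.
  - exact: measurable_funeM.
  - exact: measurable_funeM.
have := le_trans left right.
by rewrite leeD2rE// fin_numM.
Qed.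

(** [D] stands for the exponential accumulated so far. By [le_integral_weight] it is enough to bound
    the new factor on each [B] in [G], which is split along [A]. *)
Lemma integral_expR_step {d : measure_display} {T : measurableType d}
    {R : realType} (P : probability T R) (G : set_system T) (A : set T)
    (Y D : T -> R) (Z : T -> \bar R) (theta c N M : R) :
  sigma_algebra setT G -> G `<=` measurable -> G A ->
  measurable_fun setT Y -> (forall w, 0 <= Y w) ->
  (forall w, A w -> Y w <= N) -> 0 <= N -> 0 <= M -> theta * N <= 1 / 3 ->
  is_condexp P G Y Z ->
  {ae P, forall w, A w -> exists2 z, Z w = z%:E & theta * z <= theta * c /\ z <= M} ->
  (forall w, 0 <= D w) -> measurable_wrt G D ->
  (\int[P]_w (D w * expR (theta * (\1_A w * (Y w - c))))%:E
    <= (expR (theta ^+ 2 * N * M))%:E * \int[P]_w (D w)%:E)%E.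
Proof.
move=> sG Gm GA mY Y0 YN N0 M0 thN cY aeZ D0 mD.
have mA : measurable A by exact: Gm.
set K := expR _.
have K1 : 1 <= K by rewrite -expR0 ler_expR mulr_ge0// mulr_ge0// sqr_ge0.
have mD' : measurable_fun [set: T] D := measurable_wrt_measurable _ _ Gm mD.
have mF : measurable_fun setT (fun w => expR (theta * (\1_A w * (Y w - c)))).
  apply: measurableT_comp => //; apply: measurable_funM => //.
  by apply: measurable_funM => //; exact: measurable_funB.
apply: (@le_trans _ _ (\int[P]_w (D w * K)%:E)%E); last first.
  under eq_integral do rewrite mulrC EFinM.
  rewrite ge0_integralZl//; first exact/measurable_EFinP.
    by move=> w _; rewrite lee_fin.
  by rewrite lee_fin expR_ge0.
apply: (le_integral_weight P G
  (fun w => expR (theta * (\1_A w * (Y w - c)))) (fun=> K) D) => //.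
  by move=> _; exact: expR_ge0.
move=> B GB.
have mB : measurable B by exact: Gm.
have GBA : G (B `&` A).
  have mG := measurable_g_measurableTypeE sG.
  by rewrite -mG; apply: measurableI; rewrite mG.
have mBA : measurable (B `&` A) by exact: Gm.
have mBDA : measurable (B `\` A) by exact: measurableD.
have dis : [disjoint B `&` A & B `\` A].
  by apply/disj_set2P; rewrite setDE setIACA setICr setI0.
have mFE E : measurable_fun E (fun w => (expR (theta * (\1_A w * (Y w - c))))%:E).
  by apply/measurable_EFinP; exact: measurable_funTS.
rewrite -(setUIDK B A) !ge0_integral_setU//; try exact: mFE;
  try by move=> w _; rewrite lee_fin expR_ge0.
(* Off [A] the exponent is [0], and the factor is [1 <= K]. *)
apply: leeD; last first.
  apply: ge0_le_integral => //; try by move=> w _; rewrite lee_fin expR_ge0.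
  move=> w [_ nAw]; rewrite lee_fin indicE memNset//.
  by rewrite mul0r mulr0 expR0.
(* On [A] the centring comes out as [expR (- (theta * c))], which cancels the same term in the bound
   of [condexp_expR_le]. *)
rewrite integral_cst// (eq_integral (fun w =>
    (expR (- (theta * c)))%:E * (expR (theta * Y w))%:E)%E); last first.
  move=> w /[!inE] -[_ Aw]; rewrite indicE mem_set// mul1r -EFinM -expRD.
  by congr (expR _)%:E; lra.
rewrite ge0_integralZl//; last first.
  apply/measurable_EFinP; apply: measurable_funTS.
  by apply: measurableT_comp => //; exact: measurable_funM.
have := @condexp_expR_le _ _ _ P G (B `&` A) Y Z theta c N M.
move=> /(_ Gm GBA mY Y0).
have YN' w : (B `&` A) w -> Y w <= N by move=> [_]; exact: YN.
have aeZ' : {ae P, forall w, (B `&` A) w ->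
    exists2 z, Z w = z%:E & theta * z <= theta * c /\ z <= M}.
  by apply: filterS aeZ => w aeZ [_ Aw]; exact: aeZ.
move=> /(_ YN' N0 M0 thN cY aeZ').
move=> /(@lee_wpmul2l _ (expR (- (theta * c)))%:E) => /(_ _)/le_trans; apply.
  by rewrite lee_fin expR_ge0.
by rewrite muleA -EFinM -expRD addKr.
Qed.

(** * Exponential tail bound for stopped sums *)

(** Indicators replace a stopping time: the number of terms stays fixed, and the tail bound requires
    no monotonicity of [A]. *)
Definition stopped_sum {T : Type} {R : realType} (A : nat -> set T)
    (Y : nat -> T -> R) (c : nat -> R) (n : nat) (w : T) : R :=
  \sum_(k < n) \1_(A k) w * (Y k w - c k).

Lemma stopped_sumS {T : Type} {R : realType} (A : nat -> set T)
    (Y : nat -> T -> R) (c : nat -> R) (n : nat) (w : T) :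
  stopped_sum A Y c n.+1 w =
  stopped_sum A Y c n w + \1_(A n) w * (Y n w - c n).
Proof. by rewrite /stopped_sum big_ord_recr. Qed.

Lemma stopped_sum_measurable {d : measure_display} {T : measurableType d}
    {R : realType} (F : nat -> set_system T) (A : nat -> set T)
    (Y : nat -> T -> R) (c : nat -> R) (n : nat) :
  filtration F -> (forall k, (k < n)%N -> F k (A k)) ->
  (forall k, (k < n)%N -> measurable_wrt (F k.+1) (Y k)) ->
  measurable_wrt (F n) (stopped_sum A Y c n).
Proof.
move=> [sF Fm FS] FA mY; apply/measurable_wrtE => //.
apply: measurable_sum => k.
apply: measurable_funM.
  apply: measurable_indic; rewrite measurable_g_measurableTypeE//.
  by apply: (FS k); [exact: ltnW|exact: FA].
apply: measurable_funB => //; apply/measurable_wrtE => //.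
by apply: measurable_wrtS (mY k _) => //; exact: FS.
Qed.

(** Chernoff's method: by [integral_expR_step] each summand multiplies the exponential moment by at
    most [expR (theta ^+ 2 * N * M)]. A negative [theta] gives the lower tail. *)
Lemma stopped_sum_tail {d : measure_display} {T : measurableType d}
    {R : realType} (P : probability T R) (F : nat -> set_system T)
    (A : nat -> set T) (Y : nat -> T -> R) (c : nat -> R)
    (m : nat) (theta N M r : R) :
  filtration F -> (forall k, (k < m)%N -> F k (A k)) ->
  (forall k, (k < m)%N -> measurable_wrt (F k.+1) (Y k)) ->
  (forall k w, (k < m)%N -> 0 <= Y k w) ->
  (forall k w, (k < m)%N -> A k w -> Y k w <= N) ->
  0 <= N -> 0 <= M -> theta * N <= 1 / 3 ->
  (forall k, (k < m)%N -> exists2 Z, is_condexp P (F k) (Y k) Z &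
    {ae P, forall w, A k w ->
       exists2 z, Z w = z%:E & theta * z <= theta * c k /\ z <= M}) ->
  (P [set w | (r <= theta * stopped_sum A Y c m w)%R]
    <= (expR (m%:R * (theta ^+ 2 * N * M) - r))%:E)%E.
Proof.
move=> FF FA mY Y0 YN N0 M0 thN HZ; have [sF Fm FS] := FF.
have mS n : (n <= m)%N -> measurable_wrt (F n) (stopped_sum A Y c n).
  move=> nm; apply: stopped_sum_measurable => // k kn.
    by apply: FA; exact: leq_trans nm.
  by apply: mY; exact: leq_trans nm.
have mexp n : (n <= m)%N ->
    measurable_wrt (F n) (fun w => expR (theta * stopped_sum A Y c n w)).
  move=> nm; apply/measurable_wrtE => //; apply: measurableT_comp => //.
  by apply: measurable_funM => //; apply/measurable_wrtE => //; exact: mS.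
have bound n : (n <= m)%N -> (\int[P]_w (expR (theta * stopped_sum A Y c n w))%:E
    <= (expR (n%:R * (theta ^+ 2 * N * M)))%:E)%E.
  elim: n => [_|n IH nm].
    under eq_integral do rewrite /stopped_sum big_ord0 mulr0 expR0.
    by rewrite integral_cst// mul1e mul0r expR0 probability_le1.
  under eq_integral do rewrite stopped_sumS mulrDr expRD.
  have [Z cZ aeZ] := HZ n nm.
  have mYn : measurable_fun [set: T] (Y n).
    exact: measurable_wrt_measurable (mY n nm).
  apply: le_trans (integral_expR_step P (F n) (A n) (Y n)
    (fun w => expR (theta * stopped_sum A Y c n w)) Z theta (c n) N M
    _ _ _ _ _ _ _ _ _ _ _ _ _) _ => //.
  - exact: FA.
  - by move=> w; exact: Y0.
  - by move=> w; exact: YN.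
  - by apply: mexp; exact: ltnW.
  rewrite -natr1 mulrDl mul1r addrC expRD EFinM lee_wpmul2l ?lee_fin ?expR_ge0//.
  by apply: IH; exact: ltnW.
have mST : measurable_fun [set: T] (stopped_sum A Y c m).
  exact: measurable_wrt_measurable (mS m _).
have mE : measurable [set w | (r <= theta * stopped_sum A Y c m w)%R].
  rewrite -[X in measurable X]setTI; apply: measurable_fun_le => //.
  exact: measurable_funM.
rewrite -(setIT [set w | _]) -integral_indic//.
(* Markov's inequality: the indicator of the event is at most the exponential of
   [theta * stopped_sum A Y c m w - r]. *)
apply: (@le_trans _ _ (\int[P]_w ((expR (- r))%:E *
    (expR (theta * stopped_sum A Y c m w))%:E))%E).
  have mexpm : measurable_fun [set: T] (fun w => expR (theta * stopped_sum A Y c m w)).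
    exact: measurable_wrt_measurable (mexp m _).
  apply: ge0_le_integral => //=.
  - exact/measurable_EFinP/measurable_indic.
  - by apply: measurable_funeM; exact/measurable_EFinP.
  move=> w _; rewrite -EFinM -expRD lee_fin indicE.
  have [|_] := boolP (w \in _); last exact: expR_ge0.
  by rewrite inE/= => ?; rewrite -expR0 ler_expR; lra.
rewrite ge0_integralZl//.
- by rewrite addrC expRD EFinM lee_wpmul2l ?lee_fin ?expR_ge0// bound.
- apply/measurable_EFinP.
  exact: measurable_wrt_measurable (mexp m _).
Qed.

(** * Calculus on the half-line *)

Definition hl_derivable {R : realType} (f : R -> R) : Prop :=
  forall t, 0 <= t -> cvg (diff_quotient f t h @[h --> quotient_filter t]).

(** As soon as [|h| < t], the constraint [0 <= t + h] is automatic. Hence half-line derivatives are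
    ordinary ones at positive points, and the point [0] alone needs separate care. *)
Lemma quotient_filter_interior {R : realType} (t : R) :
  0 < t -> quotient_filter t = 0^'.
Proof.
move=> t0; apply/seteqP; split=> A hA; last first.
  by apply: filterS hA => h Ah _.
have h1 : \forall h \near (0:R), h != 0 -> 0 <= t + h -> A h by exact: hA.
have h2 : \forall h \near (0:R), `|h| < t.
  exact: (@nbhs0_lt _ R^o).
have h3 : \forall h \near (0:R), h != 0 -> A h.
  near=> h => h0; have /(_ h0) : h != 0 -> 0 <= t + h -> A h by near: h.
  apply; have : `|h| < t by near: h.
  by rewrite ltr_norml => /andP[? _]; lra.
exact: h3.
Unshelve. all: by end_near. Qed.

Lemma hl_derivable_is_derive {R : realType} (f : R -> R) (t : R) :
  hl_derivable f -> 0 < t -> is_derive t 1 f (hl_deriv f t).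
Proof.
move=> df t0; have := df t (ltW t0).
have dqE : diff_quotient f t = fun h => h^-1 *: (f (h *: 1 + t) - f t).
  by apply/funext => h; rewrite /diff_quotient (_ : h *: 1 + t = t + h)// addrC [h *: 1]mulr1.
rewrite dqE quotient_filter_interior// => dft.
apply: DeriveDef; first exact: dft.
by rewrite /hl_deriv dqE quotient_filter_interior.
Qed.

(** Write [f x] as [f a] plus [x - a] times the difference quotient, which converges. The case
    [a = 0] is the one that ordinary derivatives do not cover. *)
Lemma hl_derivable_cvg_right {R : realType} (f : R -> R) (a : R) :
  hl_derivable f -> 0 <= a -> f x @[x --> a^'+] --> f a.
Proof.
move=> df a0; have {}df := df a a0; pose l := hl_deriv f a.
have xa0 : x - a @[x --> a^'+] --> 0.
  rewrite -(subrr a); apply: cvgB; last exact: cvg_cst.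
  by apply: cvg_at_right_filter; exact: cvg_id.
have xaq : x - a @[x --> a^'+] --> quotient_filter a.
  move=> A hA.
  have h1 : \forall h \near (0:R), h != 0 -> 0 <= a + h -> A h by exact: hA.
  have h2 := xa0 _ h1.
  have h3 : \forall x \near a^'+, x - a != 0 -> 0 <= a + (x - a) -> A (x - a) by exact: h2.
  have h4 : \forall x \near a^'+, A (x - a).
    near=> x; have ax : a < x by near: x; exact: nbhs_right_gt.
    have : x - a != 0 -> 0 <= a + (x - a) -> A (x - a) by near: x.
    by apply; [rewrite subr_eq0 gt_eqF|lra].
  exact: h4.
have dq : diff_quotient f a (x - a) @[x --> a^'+] --> l.
  exact: cvg_comp xaq df.
have : f a + (x - a) * diff_quotient f a (x - a) @[x --> a^'+] --> f a + 0 * l.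
  by apply: cvgD; [exact: cvg_cst|exact: cvgM].
rewrite mul0r addr0; apply: cvg_trans; apply: near_eq_cvg; near=> x.
have ax : a < x by near: x; exact: nbhs_right_gt.
rewrite /diff_quotient mulrA divff ?mul1r ?subr_eq0 ?gt_eqF//.
by rewrite [a + _]addrC subrK addrC subrK.
Unshelve. all: by end_near. Qed.

Lemma hl_derivable_oo_LRcontinuous {R : realType} (f : R -> R) (a b : R) :
  hl_derivable f -> 0 <= a -> a < b -> derivable_oo_LRcontinuous f a b.
Proof.
move=> df a0 ab; split.
- move=> x; rewrite in_itv/= => /andP[ax _].
  by have [] := hl_derivable_is_derive f _ df (le_lt_trans a0 ax).
- exact: hl_derivable_cvg_right.
- have [dfb _] := hl_derivable_is_derive f _ df (le_lt_trans a0 ab).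
  apply: cvg_at_left_filter; apply: differentiable_continuous.
  exact/derivable1_diffP.
Qed.

Lemma hl_derivable_within_continuous {R : realType} (f : R -> R) (a b : R) :
  hl_derivable f -> 0 <= a -> {within `[a, b], continuous f}.
Proof.
move=> df a0; have [ab|ba|->] := ltgtP a b.
- exact: derivable_oo_LRcontinuous_within (hl_derivable_oo_LRcontinuous _ _ _ df a0 ab).
- by rewrite set_itv_ge ?bnd_simp -?ltNge//; exact: continuous_subspace0.
- by rewrite set_itv1; exact: continuous_subspace1.
Qed.

Lemma hl_derivable_measurable {R : realType} (f : R -> R) (a b : R) :
  hl_derivable f -> 0 <= a -> measurable_fun `[a, b] f.
Proof.
move=> df a0; apply: subspace_continuous_measurable_fun => //.
exact: hl_derivable_within_continuous.
Qed.

Lemma hl_derivable_norm_measurable {R : realType} (f : R -> R) (a b : R) :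
  hl_derivable f -> 0 <= a ->
  measurable_fun `[a, b] (fun t => (`|f t|%:E)).
Proof.
move=> df a0; apply/measurable_EFinP; apply: measurableT_comp => //.
exact: hl_derivable_measurable.
Qed.

(** The fundamental theorem of calculus on [[c, e]], then enlargement of the interval, so that one
    integral bounds all increments inside [[a, b]]. *)
Lemma hl_increment_le {R : realType} (f : R -> R) (a b c e : R) :
  hl_derivable f -> hl_derivable (hl_deriv f) ->
  0 <= a -> a <= c -> c <= e -> e <= b ->
  (`|f e - f c|%:E <=
    \int[lebesgue_measure]_(t in `[a, b]) `|hl_deriv f t|%:E)%E.
Proof.
move=> df ddf a0 ac ce eb.
have c0 : 0 <= c by exact: le_trans ac.
have [{}ce|->] : c < e \/ c = e by move: ce; rewrite le_eqVlt => /orP[/eqP|]; auto.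
  have := continuous_FTC2 ce (hl_derivable_within_continuous _ _ _ ddf c0)
    (hl_derivable_oo_LRcontinuous _ _ _ df c0 ce).
  have der : {in `]c, e[, derive1 f =1 hl_deriv f}.
    move=> x; rewrite in_itv/= => /andP[cx _]; rewrite derive1E.
    by have [_] := hl_derivable_is_derive f _ df (le_lt_trans c0 cx).
  move=> /(_ der) intE.
  apply: (@le_trans _ _
    (\int[lebesgue_measure]_(t in `[c, e]) `|hl_deriv f t|%:E)%E).
    rewrite -abse_EFin EFinB -intE.
    apply: le_abse_integral => //.
    by apply/measurable_EFinP; exact: hl_derivable_measurable.
  apply: ge0_subset_integral => //.
    exact: hl_derivable_norm_measurable.
  move=> t; rewrite /= !in_itv/= => /andP[ct te].
  by rewrite (le_trans ac ct) (le_trans te eb).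
by rewrite subrr normr0 integral_ge0// => t _; rewrite lee_fin.
Qed.

Lemma ge0_integral_itv_cat {R : realType} (g : R -> R) (a b c : R) :
  a <= b -> b <= c -> measurable_fun `[a, c] g -> (forall t, t \in `[a, c] -> 0 <= g t) ->
  (\int[lebesgue_measure]_(t in `[a, b]) (g t)%:E +
   \int[lebesgue_measure]_(t in `[b, c]) (g t)%:E =
   \int[lebesgue_measure]_(t in `[a, c]) (g t)%:E)%E.
Proof.
move=> ab bc mg g0.
have sub : `]b, c]%classic `<=` `[a, c].
  by move=> t; rewrite /= !in_itv/= => /andP[bt ->]; rewrite (le_trans ab (ltW bt)).
(* Dropping the point [b] makes the two intervals disjoint. *)
rewrite -(integral_itv_obnd_cbnd (r := b)); last first.
  by apply/measurable_EFinP; apply: measurable_funS mg.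
have cat : `[a, b] `|` `]b, c] = `[a, c]%classic.
  by rewrite -itv_bndbnd_setU// bnd_simp.
rewrite -ge0_integral_setU//.
- by rewrite cat.
- by rewrite cat; exact/measurable_EFinP.
- by move=> t; rewrite cat => tac; rewrite lee_fin g0.
- apply/disj_set2P; apply/seteqP; split => // t [/=].
  by rewrite !in_itv/= => /andP[_ tb] /andP[]; rewrite ltNge tb.
Qed.

(** On one cell the mean value theorem gives the increment as [delta] times the derivative at some
    point, which differs from the derivative at the left end by at most the integral of the second
    derivative's absolute value over that cell. *)
Lemma riemann_sum_deriv {R : realType} (f : R -> R) (delta : R) (n : nat) :
  hl_derivable f -> hl_derivable (hl_deriv f) -> hl_derivable (hl_deriv (hl_deriv f)) ->
  0 <= delta ->
  (`|f (n%:R * delta) - f 0 - \sum_(k < n) delta * hl_deriv f (k%:R * delta)|%:E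
   <= delta%:E * \int[lebesgue_measure]_(t in `[0%R, (n%:R * delta)%R])
        `|hl_deriv (hl_deriv f) t|%:E)%E.
Proof.
move=> df ddf dddf d0; elim: n => [|n IH].
  rewrite mul0r subrr big_ord0 subrr normr0; apply: mule_ge0 => //.
  by apply: integral_ge0 => t _; rewrite lee_fin.
have n0 : 0 <= n%:R * delta by rewrite mulr_ge0.
have nS : n%:R * delta <= n.+1%:R * delta by rewrite ler_wpM2r// ler_nat.
rewrite -(ge0_integral_itv_cat _ _ (n%:R * delta))//; last first.
  apply: measurableT_comp => //; exact: hl_derivable_measurable.
rewrite ge0_muleDr; try by apply: integral_ge0 => t _; rewrite lee_fin.
apply: le_trans (leeD IH (_ : (`|f (n.+1%:R * delta) - f (n%:R * delta)
    - delta * hl_deriv f (n%:R * delta)|%:E <= _)%E)).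
  rewrite -EFinD lee_fin big_ord_recr/=.
  by apply: le_trans (ler_normD _ _); rewrite le_eqVlt; apply/orP; left; apply/eqP;
    congr (`| _ |); ring.
have [c] := MVT_segment nS (fun x xin =>
   hl_derivable_is_derive f x df (le_lt_trans n0 (proj1 (andP xin))))
   (hl_derivable_within_continuous _ _ _ df n0).
rewrite in_itv/= => /andP[nc cn] ->.
have -> : hl_deriv f c * (n.+1%:R * delta - n%:R * delta) -
    delta * hl_deriv f (n%:R * delta) =
    delta * (hl_deriv f c - hl_deriv f (n%:R * delta)).
  by rewrite -natr1; ring.
rewrite normrM ger0_norm// EFinM lee_wpmul2l ?lee_fin//.
exact: hl_increment_le.
Qed.

(** On one cell the value of [h] at the left end exceeds [h t] by at most the integral of [|h'|]
    over the cell; integrating over [t] multiplies this error by [delta]. *)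
Lemma riemann_sum_le_integral {R : realType} (h : R -> R) (delta : R) (n : nat) :
  hl_derivable h -> hl_derivable (hl_deriv h) ->
  (forall t, 0 <= t -> 0 <= h t) -> 0 <= delta ->
  ((\sum_(k < n) delta * h (k%:R * delta))%:E
   <= \int[lebesgue_measure]_(t in `[0%R, (n%:R * delta)%R]) (h t)%:E +
      delta%:E * \int[lebesgue_measure]_(t in `[0%R, (n%:R * delta)%R])
        `|hl_deriv h t|%:E)%E.
Proof.
move=> dh ddh h0 d0; elim: n => [|n IH].
  rewrite big_ord0; apply: adde_ge0; last apply: mule_ge0 => //.
    apply: integral_ge0 => t; rewrite /= in_itv/= lee_fin => /andP[? _].
    exact: h0.
  by apply: integral_ge0 => t _; rewrite lee_fin.
have n0 : 0 <= n%:R * delta by rewrite mulr_ge0.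
have nS : n%:R * delta <= n.+1%:R * delta by rewrite ler_wpM2r// ler_nat.
have hn t : t \in `[0, n.+1%:R * delta] -> 0 <= h t.
  by rewrite in_itv/= => /andP[? _]; exact: h0.
rewrite -(ge0_integral_itv_cat _ _ (n%:R * delta))//; last first.
  exact: hl_derivable_measurable.
rewrite -(ge0_integral_itv_cat (fun t => `|hl_deriv h t|) _ (n%:R * delta))//; last first.
  apply: measurableT_comp => //; exact: hl_derivable_measurable.
rewrite ge0_muleDr; try by apply: integral_ge0 => t _; rewrite lee_fin.
rewrite addeACA big_ord_recr/= EFinD leeD//.
set a := n%:R * delta; set b := n.+1%:R * delta.
set I := (\int[lebesgue_measure]_(t in `[a, b]) `|hl_deriv h t|%:E)%E.
have I0 : (0 <= I)%E by apply: integral_ge0 => t _; rewrite lee_fin.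
have mab : lebesgue_measure `[a, b] = delta%:E.
  rewrite lebesgue_measure_itv/= lte_fin.
  have -> : b = a + delta by rewrite /b /a -natr1; ring.
  case: ltP => [_|]; first by rewrite -EFinB; congr (_%:E); ring.
  (* In the degenerate case [delta = 0] the cell is a point, of measure [0]. *)
  by rewrite gerDl => d0'; congr (_%:E); apply/eqP; rewrite eq_le d0 d0'.
have cst_int (z : \bar R) : (\int[lebesgue_measure]_(t in `[a, b]) z = z * delta%:E)%E.
  by rewrite integral_cst//; congr (_ * _)%E.
(* Both constants become integrals over the cell, which reduces the claim to a pointwise
   comparison. *)
rewrite EFinM [leLHS]muleC [(delta%:E * I)%E]muleC -!cst_int -ge0_integralD//.
- apply: ge0_le_integral => //.
  + by move=> t _; rewrite lee_fin h0.
  + apply: emeasurable_funD => //; apply/measurable_EFinP.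
    exact: hl_derivable_measurable.
  + move=> t; rewrite /= in_itv/= => /andP[at_ tb].
    have := hl_increment_le h a b a t dh ddh n0 (lexx a) at_ tb.
    rewrite -/I => /(leeD2l (h t)%:E); apply: le_trans.
    rewrite -EFinD lee_fin distrC; have := ler_norm (h a - h t); lra.
- move=> t; rewrite /= in_itv/= => /andP[at_ _].
  by rewrite lee_fin h0// (le_trans n0).
- by apply/measurable_EFinP; exact: hl_derivable_measurable.
Qed.

(** * The dynamic concentration argument *)

Lemma is_pmP {R : realType} (v a b S : R) :
  0 < S -> 0 <= b -> is_pm v a b S <-> `|v - a * S| <= b * S.
Proof.
move=> S0 b0; split=> [[_ [th th1 <-] ->]|vab].
  have -> : (a + th * b) * S - a * S = th * (b * S) by ring.
  rewrite normrM (ger0_norm (mulr_ge0 b0 (ltW S0))).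
  rewrite ler_piMl// ?mulr_ge0 ?(ltW S0)//.
  by move: th1; rewrite /= in_itv/= ler_norml.
(* The radius can vanish, and then [theta] cannot be found by division. *)
have [b0'|bn0] := eqVneq b 0.
  exists a; first by exists 0; [rewrite /= in_itv/=; lra|rewrite mul0r addr0].
  by move: vab; rewrite b0' mul0r normr_le0 subr_eq0 => /eqP.
have bS : 0 < b * S by rewrite mulr_gt0// lt_def bn0.
exists (v / S); last by rewrite divfK// gt_eqF.
exists ((v - a * S) / (b * S)).
  by rewrite /= in_itv/= -ler_norml normf_div (gtr0_norm bS) ler_pdivrMr// mul1r.
by field; rewrite bn0 gt_eqF.
Qed.

(** The side on which a sum deviates, [true] being upwards; it is independent of which of the two
    [Y] is summed. *)
Definition dir {R : realType} (b : bool) : R := if b then 1 else -1.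

(** Put [q = S / ssg]. Of the margin [beta * q] a third goes to the initial error and a third to
    three Riemann errors of at most [beta * q / 9] each, one for [x] and one for [h] with each sign.
    The last third is shared by the two signs, [beta * q / 6] each. The factor [2] before [Hi] also
    comes from the two signs. *)
Lemma deviation {R : realType} (i : nat) (s S ssg lambda beta Hi xi x0 fi X0 Xi : R)
    (Y : sign -> nat -> R) (y : sign -> nat -> R) (h : nat -> R) :
  0 < s -> 0 < S -> 0 < ssg -> 0 < beta -> 9 * ssg * lambda / beta <= s ->
  `|xi - x0 - \sum_(k < i) s^-1 * (y Plus k - y Minus k)| <= lambda / s ->
  \sum_(k < i) s^-1 * h k <= Hi + ssg * lambda / s ->
  2 * Hi + beta <= fi ->
  `|X0 - x0 * S| <= beta / (3 * ssg) * S ->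
  fi / ssg * S < `|Xi - xi * S| ->
  Xi - X0 = \sum_(k < i) (Y Plus k - Y Minus k) ->
  exists e b, beta * S / (6 * ssg) <=
    dir b * \sum_(k < i) (Y e k - (y e k + dir b * (h k / ssg)) * (S / s)).
Proof.
move=> s0 S0 ss0 be0 hs hx hh hf hX0 hXi XE; apply: contrapT => H.
have lt e b : dir b * \sum_(k < i) (Y e k - (y e k + dir b * (h k / ssg)) * (S / s))
    < beta * S / (6 * ssg).
  by rewrite ltNge; apply/negP => ?; apply: H; exists e, b.
pose SY e := \sum_(k < i) Y e k; pose Sy e := \sum_(k < i) s^-1 * y e k.
pose Sh := \sum_(k < i) s^-1 * h k.
have sumE e b : \sum_(k < i) (Y e k - (y e k + dir b * (h k / ssg)) * (S / s)) =
    SY e - Sy e * S - dir b * (Sh * S / ssg).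
  rewrite /SY /Sy /Sh sumrB -addrA -opprD; congr (_ - _).
  rewrite !mulr_suml mulr_sumr -big_split/=; apply: eq_bigr => k _.
  by field; rewrite !gt_eqF.
have xE : \sum_(k < i) s^-1 * (y Plus k - y Minus k) = Sy Plus - Sy Minus.
  by rewrite -sumrB; apply: eq_bigr => k _; rewrite mulrBr.
rewrite sumrB -/(SY Plus) -/(SY Minus) in XE.
rewrite xE in hx; rewrite -/Sh in hh.
pose q := S / ssg; have q0 : 0 < q by exact: divr_gt0.
have lA : lambda / s * S <= beta * q / 9.
  rewrite /q mulrAC ler_pdivrMr//.
  move: hs; rewrite ler_pdivrMr// => hs.
  have -> : beta * (S / ssg) / 9 * s = (s * beta) * (S / ssg) / 9 by ring.
  have -> : lambda * S = (9 * ssg * lambda) * (S / ssg) / 9.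
    by field; rewrite gt_eqF.
  by rewrite ler_pM2r ?ler_pM2r.
have hx' : `|xi - x0 - (Sy Plus - Sy Minus)| * S <= lambda / s * S by rewrite ler_pM2r.
have hx1 : xi * S - x0 * S - (Sy Plus * S - Sy Minus * S) <= lambda / s * S.
  by have := ler_norm (xi - x0 - (Sy Plus - Sy Minus)); rewrite -(ler_pM2r S0); lra.
have hx2 : - (xi * S - x0 * S - (Sy Plus * S - Sy Minus * S)) <= lambda / s * S.
  have := ler_norm (- (xi - x0 - (Sy Plus - Sy Minus))).
  by rewrite normrN -(ler_pM2r S0); lra.
have hh' : Sh * S / ssg <= Hi * q + lambda / s * S.
  have : Sh * q <= (Hi + ssg * lambda / s) * q by rewrite ler_pM2r.
  have -> : (Hi + ssg * lambda / s) * q = Hi * q + lambda / s * S.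
    by rewrite /q; field; rewrite !gt_eqF.
  by rewrite -[Sh * S / ssg]mulrA.
have hf' : (2 * Hi + beta) * q <= fi * q by rewrite ler_pM2r.
have fE : fi / ssg * S = fi * q by rewrite /q; field; rewrite gt_eqF.
have X0E : beta / (3 * ssg) * S = beta * q / 3 by rewrite /q; field; rewrite gt_eqF.
have aE : beta * S / (6 * ssg) = beta * q / 6 by rewrite /q; field; rewrite gt_eqF.
rewrite fE in hXi; rewrite X0E ler_norml in hX0; move/andP: hX0 => [hX01 hX02].
(* An upward failure of [X] contradicts the bounds for [Plus] upwards and [Minus] downwards; a
   downward failure contradicts the other two. *)
have := lt Plus true; have := lt Plus false; have := lt Minus true; have := lt Minus false.
rewrite !sumE aE /dir !mulN1r !mul1r => h1 h2 h3 h4.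
move: hXi; apply/negP; rewrite -leNgt ler_norml; apply/andP; split; lra.
Qed.

(** * Measurability of the events *)

Lemma upto_measurable {T : pointedType} {C : Type} (G : set_system T)
    (B : nat -> C -> set T) (n : nat) (Sg : C) :
  sigma_algebra setT G -> (forall k, (k < n)%N -> G (B k Sg)) -> G (upto B n Sg).
Proof.
move=> sG GB; apply: sigma_algebra_measurableW => //.
by apply: bigcup_measurable => k kn; rewrite measurable_g_measurableTypeE//; exact: GB.
Qed.

Lemma event_E_measurable {d : measure_display} {T : measurableType d}
    {R : realType} (C V : finType) (s : R) (m : nat) (F : nat -> set_system T)
    (X : C * V -> nat -> T -> R) (B : nat -> C -> set T) (x f : C * V -> R -> R)
    (ssg Ssg : C * V -> R) (i : nat) :
  filtration F -> (forall sg k, (k <= m)%N -> measurable_wrt (F k) (X sg k)) ->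
  (forall k Sg, (k <= m)%N -> F k (B k Sg)) ->
  (forall sg, 0 < Ssg sg) ->
  (forall sg (k : nat), 0 <= f sg (k%:R / s) / ssg sg) ->
  (i <= m)%N -> F i (event_E s X B x f ssg Ssg i).
Proof.
move=> [sF Fm FS] mX mB S0 f0 im.
have mG k Sg : (k <= i)%N -> F i (event_G s X x f ssg Ssg k Sg).
  move=> ki; apply: sigma_algebra_measurableW => //.
  (* The existential in [is_pm] is traded for an inequality between measurable functions, with only
     countably many intersections. *)
  have -> : event_G s X x f ssg Ssg k Sg = \bigcap_(l in [set l | (l <= k)%N])
      \bigcap_(j in [set: V]) [set w | `|X (Sg, j) l w - x (Sg, j) (l%:R / s) * Ssg (Sg, j)|
        <= f (Sg, j) (l%:R / s) / ssg (Sg, j) * Ssg (Sg, j)].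
    apply/seteqP; split => w Hw.
      by move=> l lk j _; apply/is_pmP => //; exact: Hw.
    by move=> l j lk; apply/is_pmP => //; exact: Hw.
  apply: bigcap_measurable => [|l lk]; first by exists 0%N.
  apply: fin_bigcap_measurable => [|j _]; first exact: finite_finset.
  rewrite -[X in measurable X]setTI; apply: measurable_fun_le => //.
  apply: measurableT_comp => //; apply: measurable_funB => //.
  apply/measurable_wrtE => //.
  apply: measurable_wrtS (mX _ _ _); last by rewrite (leq_trans _ im)// (leq_trans lk).
  by apply: FS; rewrite (leq_trans lk).
have mU k Sg : (k <= i)%N -> F i (upto B k Sg).
  move=> ki; apply: upto_measurable => // l lk.
  have li : (l <= i)%N by rewrite (leq_trans (ltnW lk)).
  by apply: (FS l) => //; apply: mB; rewrite (leq_trans li).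
apply: sigma_algebra_measurableW => //.
have -> : event_E s X B x f ssg Ssg i = \bigcap_(l in [set l | (l <= i)%N])
    \bigcap_(Sg in [set: C]) (upto B l Sg `|` event_G s X x f ssg Ssg l Sg).
  apply/seteqP; split => w Hw; first by move=> l li Sg _; exact: Hw.
  by move=> l Sg li; exact: Hw.
apply: bigcap_measurable => [|l li]; first by exists 0%N.
apply: fin_bigcap_measurable => [|Sg _]; first exact: finite_finset.
by apply: measurableU; rewrite measurable_g_measurableTypeE//; [exact: mU|exact: mG].
Qed.

(** * Union bound and numerical constants *)

Lemma measure_bigsetU_le {d : measure_display} {T : measurableType d}
    {R : realType} (mu : {measure set T -> \bar R}) (I : Type) (r : seq I)
    (A : I -> set T) :
  (forall i, measurable (A i)) ->
  (mu (\big[setU/set0]_(i <- r) A i) <= \sum_(i <- r) mu (A i))%E.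
Proof.
move=> mA; elim: r => [|i r IH]; first by rewrite !big_nil measure0.
rewrite !big_cons; apply: le_trans (leeD2l _ IH).
by apply: measureU2 => //; exact: bigsetU_measurable.
Qed.

(** One factor [expR (- u sg)] pays for [#|C|], one for [#|V|], and the third is bounded by the
    maximum. *)
Lemma sum_expR_le_max {R : realType} (C V : finType) (u : C * V -> R) :
  (((maxn #|C| #|V|)%:R : R)%:E
    <= \big[Order.min/+oo]_(sg : C * V) (expR (u sg))%:E)%E ->
  \sum_(sg : C * V) expR (- (3 * u sg)) <= \big[Num.max/0]_(sg : C * V) expR (- u sg).
Proof.
move=> card_le; set Mx := (X in _ <= X).
have Mx0 : 0 <= Mx by exact: bigmax_ge_id.
have leMx sg : expR (- u sg) <= Mx by exact: le_bigmax.
have cE sg : ((maxn #|C| #|V|)%:R : R) <= expR (u sg).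
  by rewrite -lee_fin; apply: le_trans card_le _; exact: bigmin_le_cond.
pose K : R := #|{: C * V}|%:R.
apply: (@le_trans _ _ (\sum_(sg : C * V) K^-1 * Mx)); last first.
  rewrite sumr_const -/K -mulr_natl -/K mulrA.
  have [->|K0] := eqVneq K 0; first by rewrite mul0r mul0r.
  by rewrite divff// mul1r.
apply: ler_sum => sg _.
have -> : - (3 * u sg) = - u sg - u sg + - u sg by lra.
rewrite expRD ler_pM// ?expR_ge0// expRD.
have K0 : 0 < K.
  by rewrite ltr0n; apply/card_gt0P; exists sg.
rewrite !expRN -invfM lef_pV2 ?posrE ?mulr_gt0 ?expR_gt0//.
rewrite /K card_prod natrM ler_pM//; apply: le_trans (cE sg); rewrite ler_nat.
  exact: leq_maxl.
exact: leq_maxr.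
Qed.

(** The two bounds on [m] together force [beta / (ssg * lambda) < tau / 108], while [theta * N]
    equals [36] times the left side over [tau]. In the second claim [3888 = 36 ^ 2 * 3] is twice
    [1944]. *)
Lemma tail_constants {R : realType} (s m u lambda beta tau ssg S : R) :
  0 < s -> 0 < u -> 0 < lambda -> 0 < beta -> 0 < tau -> 0 < ssg -> 0 < S ->
  s / (18 * ssg * lambda / beta) < m -> m <= s * (tau / 1944) ->
  let theta := 36 * ssg * u / (beta * S) in
  let N := beta ^+ 2 / (ssg ^+ 2 * lambda * tau) * (S / u) in
  theta * N <= 1 / 3 /\ m * (theta ^+ 2 * N * (3 * lambda * S / s)) <= 2 * u.
Proof.
move=> s0 u0 l0 be0 t0 ss0 S0 mgt mle theta N.
have nz : (s != 0) * (u != 0) * (lambda != 0) * (beta != 0) * (tau != 0) *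
  (ssg != 0) * (S != 0) by rewrite !gt_eqF.
split.
  have -> : theta * N = 36 * (beta / (ssg * lambda)) / tau.
    by rewrite /theta /N; field; rewrite !nz.
  rewrite ler_pdivrMr//.
  have : s / (18 * ssg * lambda / beta) < s * (tau / 1944) by exact: lt_le_trans mle.
  rewrite ltr_pM2l//.
  have -> : (18 * ssg * lambda / beta)^-1 = beta / (ssg * lambda) / 18.
    by field; rewrite !nz.
  lra.
pose q := u / (tau * s).
have q0 : 0 < q by rewrite divr_gt0// mulr_gt0.
have -> : m * (theta ^+ 2 * N * (3 * lambda * S / s)) = 3888 * (m * q).
  by rewrite /theta /N /q; field; rewrite !nz.
have : m * q <= s * (tau / 1944) * q by rewrite ler_pM2r.
have -> : s * (tau / 1944) * q = u / 1944 by rewrite /q; field; rewrite !nz.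
lra.
Qed.

(** At the least failing time [i] some [Sg] lies outside [upto B i], hence outside all earlier
    [upto B k]. Since [E k] holds for [k < i], the tracking of [Sg] was correct then, so it breaks
    exactly at time [i]. *)
Lemma first_failure {T : Type} {R : realType} {C V : Type} (s : R)
    (X : C * V -> nat -> T -> R) (B : nat -> C -> set T)
    (x f : C * V -> R -> R) (ssg Ssg : C * V -> R) (m : nat) (w : T) :
  let E := event_E s X B x f ssg Ssg in
  ~ E m w ->
  exists i Sg j, [/\ (i <= m)%N, forall k, (k < i)%N -> E k w,
    forall k, (i <= k)%N -> ~ E k w, ~ upto B i Sg w &
    ~ is_pm (X (Sg, j) i w) (x (Sg, j) (i%:R / s))
        (f (Sg, j) (i%:R / s) / ssg (Sg, j)) (Ssg (Sg, j))].
Proof.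
move=> E Em; have exi : exists i, `[< ~ E i w >] by exists m; apply/asboolP.
have [i /asboolP Ei imin] := ex_minnP exi.
have Ek k : (k < i)%N -> E k w.
  move=> ki; apply: contrapT => nEk.
  by have /imin : `[< ~ E k w >] by [apply/asboolP]; rewrite leqNgt ki.
have im : (i <= m)%N by apply: imin; apply/asboolP.
have : exists Sg, ~ upto B i Sg w /\ ~ event_G s X x f ssg Ssg i Sg w.
  apply: contrapT => H; apply: Ei => k Sg; rewrite leq_eqVlt => /predU1P[->|ki].
    by apply: contrapT => K; apply: H; exists Sg; split=> ?; apply: K; [left|right].
  exact: (Ek k ki k Sg (leqnn k)).
move=> [Sg [nU nG]].
have : exists j, ~ is_pm (X (Sg, j) i w) (x (Sg, j) (i%:R / s))
        (f (Sg, j) (i%:R / s) / ssg (Sg, j)) (Ssg (Sg, j)).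
  apply: contrapT => H; apply: nG => k j; rewrite leq_eqVlt => /predU1P[->|ki].
    by apply: contrapT => K; apply: H; exists j.
  have [[l /= lk Bl]|] := Ek k ki k Sg (leqnn k); last exact.
  by case: nU; exists l => //=; exact: leq_trans lk (ltnW ki).
move=> [j nj]; exists i, Sg, j; split=> // k ik Ekw.
by apply: Ei => l Sg' li; apply: Ekw; exact: leq_trans li ik.
Qed.

Theorem lemma5p3 (R : realType) (d : measure_display) (T : measurableType d)
  (P : probability T R)
  (m : nat) (s : R) (m_gt0 : (0 < m)%N) (s_gt0 : 0 < s)
  (C V : finType)
  (F : nat -> set_system T) (F_filtration : filtration F)
  (X : C * V -> nat -> T -> R)
  (Y : sign -> C * V -> nat -> T -> R)
  (X_meas : forall sg i, (i <= m)%N -> measurable_wrt (F i) (X sg i))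
  (X_ge0 : forall sg i w, (i <= m)%N -> 0 <= X sg i w)
  (Y_meas : forall e sg i, (i < m)%N -> measurable_wrt (F i.+1) (Y e sg i))
  (Y_ge0 : forall e sg i w, (i < m)%N -> 0 <= Y e sg i w)
  (X_step : forall sg i w, (i < m)%N ->
    X sg i.+1 w - X sg i w = Y Plus sg i w - Y Minus sg i w)
  (B : nat -> C -> set T)
  (B_meas : forall i Sg, (i <= m)%N -> F i (B i Sg))
  (u lambda beta tau ssg Ssg : C * V -> R)
  (u_gt0 : forall sg, 0 < u sg)
  (lambda_gt0 : forall sg, 0 < lambda sg)
  (beta_gt0 : forall sg, 0 < beta sg)
  (tau_gt0 : forall sg, 0 < tau sg)
  (ssg_gt0 : forall sg, 0 < ssg sg)
  (Ssg_gt0 : forall sg, 0 < Ssg sg)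
  (x f : C * V -> R -> R)
  (x_smooth : forall sg, smooth_nonneg (x sg))
  (f_smooth : forall sg, smooth_nonneg (f sg))
  (H : nat -> set T)
  (H_meas : forall i, (i <= m)%N -> F i (H i))
  (H_decr : forall i, (i < m)%N -> H i.+1 `<=` H i)
  (y : sign -> C * V -> R -> R) (h : C * V -> R -> R)
  (y_smooth : forall e sg, smooth_nonneg (y e sg))
  (h_smooth : forall sg, smooth_nonneg (h sg))
  (E := event_E s X B x f ssg Ssg)
  (* trend hypothesis *)
  (trend : forall (i : nat) (Sg : C) (j : V) (e : sign), (i < m)%N ->
    let sg := (Sg, j) in let t := i%:R / s in
    exists2 Z : T -> \bar R, is_condexp P (F i) (Y e sg i) Z &
      {ae P, forall w, (E i `&` ~` upto B i.+1 Sg `&` H i) w ->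
        exists2 z : R, Z w = z%:E &
          is_pm z (y e sg t) (h sg t / ssg sg) (Ssg sg / s)})
  (trend_x : forall sg (t : R), 0 <= t ->
    hl_deriv (x sg) t = y Plus sg t - y Minus sg t)
  (trend_f : forall sg (t : R), 0 <= t ->
    (2%:E * \int[lebesgue_measure]_(r in `[0%R, t]) (h sg r)%:E
       + (beta sg)%:E <= (f sg t)%:E)%E)
  (* boundedness hypothesis *)
  (bounded : forall (i : nat) (Sg : C) (j : V) (e : sign) (w : T), (i < m)%N ->
    let sg := (Sg, j) in
    (E i `&` ~` upto B i.+1 Sg `&` H i) w ->
    Y e sg i w <=
      beta sg ^+ 2 / (ssg sg ^+ 2 * lambda sg * tau sg) * (Ssg sg / u sg))
  (* initial conditions *)
  (initial : forall sg w,
    is_pm (X sg 0%N w) (x sg 0) (beta sg / (3 * ssg sg)) (Ssg sg))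
  (* bounded number of configurations and variables *)
  (card_le : (((maxn #|C| #|V|)%:R : R)%:E
    <= \big[Order.min/+oo]_(sg : C * V) (expR (u sg))%:E)%E)
  (* additional technical assumptions *)
  (s_ge : forall sg,
    Num.max (15 * u sg * tau sg * (ssg sg * lambda sg / beta sg) ^+ 2)
            (9 * ssg sg * lambda sg / beta sg) <= s)
  (m_gt : forall sg, s / (18 * ssg sg * lambda sg / beta sg) < m%:R)
  (m_le : forall sg, m%:R <= s * (tau sg / 1944))
  (y_sup : forall e sg,
    (ereal_sup [set (y e sg t)%:E | t in `[0%R, (m%:R / s)%R]]
       <= (lambda sg)%:E)%E)
  (x_int : forall sg,
    (\int[lebesgue_measure]_(t in `[0%R, (m%:R / s)%R])
       `|hl_deriv (hl_deriv (x sg)) t|%:E <= (lambda sg)%:E)%E)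
  (h_0 : forall sg, h sg 0 <= ssg sg * lambda sg)
  (h_int : forall sg,
    (\int[lebesgue_measure]_(t in `[0%R, (m%:R / s)%R])
       `|hl_deriv (h sg) t|%:E <= (ssg sg * lambda sg)%:E)%E) :
  (P (~` E m `&` H m)
    <= (4 * \big[Num.max/0]_(sg : C * V) expR (- u sg))%:E)%E.
Proof.
have [sF Fm FS] := F_filtration.
have s0 := s_gt0.
have t0 (k : nat) : 0 <= k%:R / s by rewrite divr_ge0// ltW.
have f0 sg (k : nat) : 0 <= f sg (k%:R / s) / ssg sg.
  by apply: divr_ge0; [exact: (f_smooth sg).2|exact: ltW].
have tm (k : nat) : (k <= m)%N -> k%:R / s <= m%:R / s.
  by move=> km; rewrite ler_pM2r ?invr_gt0// ler_nat.
have dx sg : [/\ hl_derivable (x sg), hl_derivable (hl_deriv (x sg)) &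
    hl_derivable (hl_deriv (hl_deriv (x sg)))].
  by have [sx _] := x_smooth sg; split; [exact: (sx 0%N)|exact: (sx 1%N)|exact: (sx 2%N)].
have dh sg : hl_derivable (h sg) /\ hl_derivable (hl_deriv (h sg)).
  by have [sh _] := h_smooth sg; split; [exact: (sh 0%N)|exact: (sh 1%N)].
have yle e sg (k : nat) : (k <= m)%N -> y e sg (k%:R / s) <= lambda sg.
  move=> km; rewrite -lee_fin; apply: le_trans (y_sup e sg).
  by apply: ereal_sup_ubound; exists (k%:R / s) => //=; rewrite in_itv/= t0 tm.
have hle sg (k : nat) : (k <= m)%N -> h sg (k%:R / s) <= 2 * (ssg sg * lambda sg).
  move=> km; have [dh1 dh2] := dh sg.
  have := hl_increment_le (h sg) 0 (m%:R / s) 0 (k%:R / s) dh1 dh2 (lexx 0)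
    (lexx 0) (t0 k) (tm k km).
  move=> /le_trans /(_ (h_int sg)); rewrite lee_fin.
  have := ler_norm (h sg (k%:R / s) - h sg 0); have := h_0 sg; lra.
(* [good] decreases in [k], so a sum over all [k < m] weighted by its
   indicators is the sum stopped at the first failure. *)
pose good Sg k := E k `&` ~` upto B k.+1 Sg `&` H k.
pose theta sg b : R := dir b * (36 * ssg sg * u sg / (beta sg * Ssg sg)).
pose N sg := beta sg ^+ 2 / (ssg sg ^+ 2 * lambda sg * tau sg) * (Ssg sg / u sg).
(* Here [lambda] bounds [y], and [2 * lambda] bounds [h / ssg]. *)
pose M sg := 3 * lambda sg * Ssg sg / s.
(* The end of the trend interval on the side of the deviation: upper for [b = true], lower for
   [b = false]. *)
pose cc sg e b k := (y e sg (k%:R / s) + dir b * (h sg (k%:R / s) / ssg sg)) * (Ssg sg / s).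
pose sgn (b : bool) := if b then Plus else Minus.
pose Ev (q : C * V * (bool * bool)) := [set w | (6 * u q.1 <=
  theta q.1 q.2.2 * stopped_sum (good q.1.1) (Y (sgn q.2.1) q.1)
    (cc q.1 (sgn q.2.1) q.2.2) m w)%R].
have goodF Sg k : (k < m)%N -> F k (good Sg k).
  move=> km; have km' := ltnW km.
  have FE : F k (E k) by exact: (event_E_measurable _ _ _ m).
  have FU : F k (upto B k.+1 Sg).
    apply: upto_measurable => // l lk.
    by apply: (FS l) => //; apply: B_meas; rewrite ltnS in lk; exact: leq_trans lk km'.
  apply: sigma_algebra_measurableW => //; apply: measurableI.
    apply: measurableI; first by rewrite measurable_g_measurableTypeE.
    by apply: measurableC; rewrite measurable_g_measurableTypeE.
  by rewrite measurable_g_measurableTypeE//; exact: H_meas.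
have N0 sg : 0 <= N sg.
  by rewrite /N !mulr_ge0 ?invr_ge0 ?mulr_ge0 ?exprn_ge0 ?ltW.
have M0 sg : 0 <= M sg by rewrite /M !mulr_ge0 ?invr_ge0 ?ltW.
have tail q : (P (Ev q) <= (expR (- (3 * u q.1)))%:E)%E.
  case: q => [[Sg j] [be b]]; rewrite /Ev/=; set sg := (Sg, j); set e := sgn be.
  have [tN tV] := tail_constants s m%:R (u sg) (lambda sg) (beta sg) (tau sg)
    (ssg sg) (Ssg sg) s0 (u_gt0 sg) (lambda_gt0 sg) (beta_gt0 sg) (tau_gt0 sg)
    (ssg_gt0 sg) (Ssg_gt0 sg) (m_gt sg) (m_le sg).
  have th0 : 0 < 36 * ssg sg * u sg / (beta sg * Ssg sg).
    by rewrite divr_gt0 ?mulr_gt0.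
  have thN : theta sg b * N sg <= 1 / 3.
    rewrite /theta /dir; case: b; first by rewrite (mul1r (_ / (_ * _))); exact: tN.
    by rewrite mulN1r mulNr; have := mulr_ge0 (ltW th0) (N0 sg); lra.
  apply: le_trans (stopped_sum_tail P F (good Sg) (Y e sg) (cc sg e b) m
    (theta sg b) (N sg) (M sg) (6 * u sg) F_filtration _ _ _ _ _ _ _ _) _ => //.
  - by move=> k; exact: goodF.
  - by move=> k; exact: Y_meas.
  - by move=> k w; exact: Y_ge0.
  - by move=> k w km; exact: bounded.
  - move=> k km; have [Z cZ aeZ] := trend k Sg j e km.
    exists Z => //; apply: filterS aeZ => w aeZ gw.
    have [z zE zpm] := aeZ gw; exists z => //.
    have hn0 : 0 <= h sg (k%:R / s) / ssg sg.
      by apply: divr_ge0; [exact: (h_smooth sg).2|exact: ltW].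
    have Ss0 : 0 < Ssg sg / s by rewrite divr_gt0.
    move/(is_pmP _ _ _ _ Ss0 hn0) : zpm; rewrite ler_norml => /andP[z1 z2].
    split.
      rewrite /theta /cc /dir; case: b {thN} => /=.
        by rewrite !mul1r ler_pM2l//; lra.
      by rewrite !mulN1r !mulNr lerN2 ler_pM2l//; lra.
    have h1 := yle e sg k (ltnW km).
    have h2 : h sg (k%:R / s) / ssg sg <= 2 * lambda sg.
      by rewrite ler_pdivrMr//; have := hle sg k (ltnW km); lra.
    have : (y e sg (k%:R / s) + h sg (k%:R / s) / ssg sg) * (Ssg sg / s)
        <= (3 * lambda sg) * (Ssg sg / s).
      by rewrite ler_pM2r//; lra.
    rewrite /M -[3 * lambda sg * Ssg sg / s]mulrA; lra.
  (* The exponent is at most [2 * u - 6 * u], which leaves room below [- (3 * u)]. *)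
  rewrite lee_fin ler_expR.
  have -> : theta sg b ^+ 2 = (36 * ssg sg * u sg / (beta sg * Ssg sg)) ^+ 2.
    by rewrite /theta /dir; case: b {thN}; rewrite ?mul1r ?mulN1r ?sqrrN.
  have := u_gt0 sg; rewrite -/(N sg) -/(M sg) in tV; lra.
have cover : ~` E m `&` H m `<=` \big[setU/set0]_(q : C * V * (bool * bool)) Ev q.
  move=> w [nE Hw].
  have [i [Sg [j [im Ek nEk nU npm]]]] := first_failure _ _ _ _ _ _ _ _ _ nE.
  set sg := (Sg, j) in npm.
  have Hsub n : (n <= m)%N -> H (m - n)%N w.
    elim: n => [|n IH nm]; first by rewrite subn0.
    apply: H_decr; first by rewrite ltn_subrL m_gt0.
    by rewrite subnSK//; apply: IH; exact: ltnW.
  have Hk k : (k <= m)%N -> H k w.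
    by move=> km; rewrite -(subKn km); apply: Hsub; exact: leq_subr.
  (* For [k < i], [upto B k.+1] is contained in [upto B i], which [w] avoids; from [i] on, [E k]
     fails. So the stopped sum keeps exactly the terms with [k < i]. *)
  have goodk k : (k < m)%N -> \1_(good Sg k) w = (k < i)%N%:R :> R.
    move=> km; rewrite indicE; congr ((nat_of_bool _)%:R); apply/idP/idP => [|ki].
      by rewrite inE => -[[Ekw _] _]; rewrite ltnNge; apply/negP => /nEk.
    rewrite inE; split; last by apply: Hk; exact: ltnW.
    split; first exact: Ek.
    by move=> [l /= lk Bl]; apply: nU; exists l => //=; exact: leq_trans lk ki.
  have sumE e b : stopped_sum (good Sg) (Y e sg) (cc sg e b) m w =
      \sum_(k < i) (Y e sg k w - cc sg e b k).
    rewrite /stopped_sum (big_ord_widen m (fun k => Y e sg k w - cc sg e b k) im).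
    rewrite [RHS]big_mkcond/=; apply: eq_bigr => k _.
    by rewrite goodk//; case: ifP; rewrite ?mul1r ?mul0r.
  pose Hint := fine (\int[lebesgue_measure]_(r in `[0%R, (i%:R / s)%R]) (h sg r)%:E)%E.
  (* The integral is finite because [trend_f] bounds it by a real value of [f]. *)
  have HintE : (\int[lebesgue_measure]_(r in `[0%R, (i%:R / s)%R]) (h sg r)%:E)%E = Hint%:E.
    have I0 : (0 <= \int[lebesgue_measure]_(r in `[0%R, (i%:R / s)%R]) (h sg r)%:E)%E.
      apply: integral_ge0 => r; rewrite /= in_itv/= => /andP[r0 _].
      by rewrite lee_fin; apply: (h_smooth sg).2.
    rewrite /Hint fineK// ge0_fin_numE// ltey; apply/eqP => Iy.
    by have := trend_f sg _ (t0 i); rewrite Iy mulry gtr0_sg// mul1e addye.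
  (* The hypotheses bound integrals up to [m / s], the Riemann estimates involve them up to
     [i / s]. *)
  have subint (g : R -> R) : hl_derivable g ->
      (\int[lebesgue_measure]_(t in `[0%R, (i%:R / s)%R]) `|g t|%:E <=
       \int[lebesgue_measure]_(t in `[0%R, (m%:R / s)%R]) `|g t|%:E)%E.
    move=> dg; apply: ge0_subset_integral => //.
      exact: hl_derivable_norm_measurable.
    by move=> t; rewrite /= !in_itv/= => /andP[-> /le_trans]; apply; exact: tm.
  have [dx1 dx2 dx3] := dx sg; have [dh1 dh2] := dh sg.
  have si0 : 0 <= s^-1 by rewrite invr_ge0 ltW.
  have hx : `|x sg (i%:R / s) - x sg 0 - \sum_(k < i) s^-1 *
      (y Plus sg (k%:R / s) - y Minus sg (k%:R / s))| <= lambda sg / s.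
    rewrite -lee_fin; under eq_bigr do rewrite -trend_x//.
    apply: le_trans (riemann_sum_deriv _ _ i dx1 dx2 dx3 si0) _.
    rewrite EFinM muleC lee_wpmul2r ?lee_fin//.
    exact: le_trans (subint _ dx3) (x_int sg).
  have hh : \sum_(k < i) s^-1 * h sg (k%:R / s) <= Hint + ssg sg * lambda sg / s.
    rewrite -lee_fin.
    apply: le_trans (riemann_sum_le_integral _ _ i dh1 dh2 (h_smooth sg).2 si0) _.
    rewrite HintE EFinD leeD2l// EFinM muleC lee_wpmul2r ?lee_fin//.
    exact: le_trans (subint _ dh2) (h_int sg).
  have hf : 2 * Hint + beta sg <= f sg (i%:R / s).
    by have := trend_f sg _ (t0 i); rewrite HintE -EFinM -EFinD lee_fin.
  have hX0 : `|X sg 0%N w - x sg 0 * Ssg sg| <= beta sg / (3 * ssg sg) * Ssg sg.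
    by apply/is_pmP; rewrite ?divr_ge0 ?mulr_ge0 ?ltW.
  have hXi : f sg (i%:R / s) / ssg sg * Ssg sg < `|X sg i w - x sg (i%:R / s) * Ssg sg|.
    by rewrite ltNge; apply/negP => K; apply: npm; apply/is_pmP.
  have XE n : (n <= m)%N -> X sg n w - X sg 0%N w =
      \sum_(k < n) (Y Plus sg k w - Y Minus sg k w).
    elim: n => [|n IH nm]; first by rewrite subrr big_ord0.
    by rewrite big_ord_recr/= -IH ?(ltnW nm)// -X_step// addrC subrKA.
  have hs : 9 * ssg sg * lambda sg / beta sg <= s.
    by have := s_ge sg; rewrite ge_max => /andP[].
  have [e [b]] := deviation i s (Ssg sg) (ssg sg) (lambda sg) (beta sg) Hint
    (x sg (i%:R / s)) (x sg 0) (f sg (i%:R / s)) (X sg 0%N w) (X sg i w)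
    (fun e k => Y e sg k w) (fun e k => y e sg (k%:R / s)) (fun k => h sg (k%:R / s))
    s0 (Ssg_gt0 sg) (ssg_gt0 sg) (beta_gt0 sg) hs hx hh hf hX0 hXi (XE i im).
  move=> dev.
  have [be beE] : exists be, sgn be = e by case: e {dev}; [exists true|exists false].
  rewrite (bigD1 (sg, (be, b)))//=; left; rewrite /Ev/= beE -/sg sumE.
  have th0 : 0 < 36 * ssg sg * u sg / (beta sg * Ssg sg).
    by rewrite divr_gt0 ?mulr_gt0 ?mulr_gt0//.
  have -> : 6 * u sg = 36 * ssg sg * u sg / (beta sg * Ssg sg) *
      (beta sg * Ssg sg / (6 * ssg sg)) by field; rewrite !gt_eqF.
  by rewrite /theta [dir b * _]mulrC -[leRHS]mulrA ler_pM2l.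
have mEv q : measurable (Ev q).
  rewrite /Ev -[X in measurable X]setTI; apply: measurable_fun_le => //.
  apply: measurable_funM => //; apply: (@measurable_wrt_measurable _ _ _ _ (F m)) => //.
  apply: stopped_sum_measurable => // k km; [exact: goodF|exact: Y_meas].
apply: (@le_trans _ _ (P (\big[setU/set0]_(q : C * V * (bool * bool)) Ev q))).
  apply: le_measure => //; rewrite inE; last by apply: bigsetU_measurable.
  apply: measurableI; last exact/Fm/H_meas.
  by apply: measurableC; apply: Fm; exact: (event_E_measurable _ _ _ m).
apply: le_trans (measure_bigsetU_le _ _ _ _ mEv) _.
apply: (@le_trans _ _ (\sum_(q : C * V * (bool * bool)) (expR (- (3 * u q.1)))%:E)%E).
  by apply: lee_sum => q _; exact: tail.
rewrite sumEFin lee_fin.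
(* The bound ignores the two booleans, so summing over them yields the factor [4]. *)
rewrite -(pair_bigA _ (fun sg _ => expR (- (3 * u sg))))/=.
under eq_bigr do rewrite sumr_const card_prod card_bool.
rewrite sumrMnl -[leLHS]mulr_natl ler_pM2l//.
exact: sum_expR_le_max.
Qed.
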